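(* Let $q$ be a prime power and $n\ge 2$ an integer. Let $C=\{\mathcal A_1,\ldots,\mathcal A_n\}$ be a collection of $\mathbb F_q$-affine hyperplanes of $\mathbb F_{q^n}$ in general position, let $\mathcal S_C^*=\bigcap_{i=1}^n\left(\mathbb F_{q^n}\setminus\mathcal A_i\right)$, and let $\mathcal P(\mathcal S_C^* )$ be the number of primitive elements of $\mathbb F_{q^n}$ lying in $\mathcal S_C^*$. Then $$\frac{q^n-1}{\varphi(q^n-1)}\,\mathcal P(\mathcal S_C^* )>(q-1)^n-\delta(q,n)\cdot W(q^n-1),$$ where $\delta(q,n)=\sum_{i=0}^{n-1}\binom{n}{i}q^{\min\{i,\,n/2\}}$.
   Context: $\mathbb F_{q^n}$ is regarded as an $n$-dimensional vector space over $\mathbb F_q$. An $\mathbb F_q$-affine space of dimension $t$ is a set $u+V$ with $u\in\mathbb F_{q^n}$ and $V$ an $\mathbb F_q$-linear subspace of dimension $t$; an $\mathbb F_q$-affine hyperplane has dimension $n-1$. The collection $C$ is in general position if for each $1\le k\le n$ the intersection of any $k$ distinct elements of $C$ is an $\mathbb F_q$-affine space of dimension $n-k$. A primitive element is a generator of $\mathbb F_{q^n}^*$. $\varphi$ is Euler's totient function, and $W(t)$ denotes the number of squarefree positive divisors of $t$. *)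

(* Defs.v *)
From HB Require Import structures.
From mathcomp Require Import all_boot all_order all_algebra.
From mathcomp Require Import fingroup cyclic fieldext finfield.
From mathcomp Require Import reals exp.

Set Implicit Arguments.
Unset Strict Implicit.
Unset Printing Implicit Defensive.
Import Order.TTheory GRing.Theory Num.Theory.
Local Open Scope ring_scope.

(* For L an extension of degree n of F with #|F| = q, the carrier of F_{q^n} is
   [finvect_type L], the copy of L on which mathcomp puts the finite field
   structure. *)

Section Affine.
Variables (F : finFieldType) (L : fieldExtType F).
Local Notation K := (finvect_type L).

Definition is_affine_space (t : nat) (A : {set K}) : Prop :=
  exists (u : K) (V : {vspace K}), \dim V = t /\ A = [set u + v | v in V].

Definition is_affine_hyperplane (A : {set K}) : Prop :=
  is_affine_space (\dim {:L}).-1 A.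

Definition general_position (C : {set {set K}}) : Prop :=
  forall (k : nat) (D : {set {set K}}),
    (1 <= k <= \dim {:L})%N -> D \subset C -> #|D| = k ->
    is_affine_space (\dim {:L} - k) (\bigcap_(A in D) A).

Definition avoiding_set (C : {set {set K}}) : {set K} :=
  \bigcap_(A in C) ~: A.

Definition primitive_element (x : K) : bool :=
  [exists w : {unit K}, (x == val w) && generator [set: {unit K}] w].

Definition num_primitive (S : {set K}) : nat :=
  #|[set x in S | primitive_element x]|.

End Affine.

Definition squarefree (d : nat) : bool :=
  (0 < d)%N && all (fun e => (e ^ 2 %| d)%N ==> (e == 1)%N) (divisors d).

Definition num_squarefree_divisors (t : nat) : nat :=
  size [seq d <- divisors t | squarefree d].

Definition delta (R : realType) (q n : nat) : R :=
  \sum_(0 <= i < n) 'C(n, i)%:R * q%:R `^ Num.min i%:R (n%:R / 2).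

(* Main.v *)
(** Write N = q^n - 1 and let omega be the number of primes dividing N. The
    sieve product over the primes p | N of 1 - (p-1)^-1 * (sum of the p-1 characters
    of order p) equals N/phi(N) on primitive elements and 0 on the other nonzero
    elements. Expanded into multiplicative characters it has l^1-norm at most
    2^omega <= W(N), and its trivial coefficient is its average, namely 1.
    By inclusion-exclusion and general position the trivial character
    contributes at least (q-1)^n - 1. For a nontrivial character the sum over
    an affine space u + V is at most |V|, and also at most q^(n/2): the second
    moment over x of the sums over x + V is exactly |V| (q^n - |V|), and each
    coset of V is met |V| times. So each nontrivial character contributes
    at most delta, and delta > 1 absorbs the loss of 1. *)
Require Import Defs.
From HB Require Import structures.
From mathcomp Require Import all_boot all_order all_algebra.
From mathcomp Require Import fingroup cyclic fieldext finfield.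
From mathcomp Require Import reals exp.
From mathcomp Require Import separable cyclotomic.
From mathcomp.real_closed Require Import complex.
From mathcomp Require Import zify ring lra.
Set Implicit Arguments.
Unset Strict Implicit.
Unset Printing Implicit Defensive.
Import Order.TTheory GRing.Theory Num.Theory.
Local Open Scope ring_scope.

(** * Multiplicative characters and their sums over additive cosets *)

Section CharacterSums.
Variables (K : finFieldType) (C : numClosedFieldType).
Implicit Types (f : K -> C) (V : {set K}).

(** The trivial character also takes the value 0 at 0, so it is the indicator of the nonzero
    elements. *)
Definition mulchar f :=
  [/\ f 0 = 0, {morph f : x y / x * y} & forall x, x != 0 -> `|f x| = 1].

Definition nontrivial f := exists2 y, y != 0 & f y != 1.

Lemma mulchar1 f : mulchar f -> f 1 = 1.
Proof.
case=> _ fM fN; have f1nz : f 1 != 0.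
  by rewrite -normr_eq0 fN ?oner_eq0.
by apply: (mulfI f1nz); rewrite -fM !mulr1.
Qed.

(** Replacing [x] by [y * x], where [f y != 1], multiplies the sum by [f y] without changing it. *)
Lemma sum_mulchar f : mulchar f -> nontrivial f -> \sum_x f x = 0.
Proof.
case=> _ fM _ [y ynz fy]; apply/eqP.
have: (1 - f y) * \sum_x f x == 0.
  rewrite mulrBl mul1r subr_eq0 mulr_sumr; apply/eqP.
  rewrite (reindex_onto (fun x => y * x) (fun x => y^-1 * x)) /=; last first.
    by move=> x _; rewrite mulVKf.
  by apply: eq_big => [x|x _]; rewrite ?mulKf ?eqxx ?fM.
by rewrite mulf_eq0 subr_eq0 eq_sym (negPf fy).
Qed.

Lemma mulcharV f x : mulchar f -> (f x)^* = f x^-1.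
Proof.
move=> fP; have [f0 fM fN] := fP.
have [->|xnz] := eqVneq x 0; first by rewrite invr0 f0 conjC0.
have fxnz : f x != 0 by rewrite -normr_eq0 fN ?oner_eq0.
by apply: (mulfI fxnz); rewrite -normCK fN // expr1n -fM divff // mulchar1.
Qed.

(** For [x != 0] the term is [f (1 + d / x)], and [d / x] runs through all nonzero elements. The
    full sum of [f (1 + y)] is 0, and its missing term at [y = 0] is 1. *)
Lemma sum_mulchar_shift f (d : K) : mulchar f -> nontrivial f -> d != 0 ->
  \sum_x f (x + d) * (f x)^* = -1.
Proof.
move=> fP fnt dnz; have [f0 fM _] := fP.
have -> : -1 = \sum_(y | y != 0) f (1 + y).
  have: \sum_y f (1 + y) = 0.
    rewrite -[RHS](sum_mulchar fP fnt) [RHS](reindex_inj (addrI 1)) //.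
  rewrite (bigD1 0) //= addr0 mulchar1 // => /eqP.
  by rewrite addrC addr_eq0 => /eqP->.
rewrite (bigD1 0) //= f0 conjC0 mulr0 add0r.
rewrite (reindex_onto (fun x => d / x) (fun x => d / x)) /=; last first.
  by move=> x xnz; rewrite invf_div mulrCA divff // mulr1.
apply: eq_big => [x|x].
  rewrite mulf_eq0 invr_eq0 (negPf dnz) /=; case: eqVneq => //= xnz.
  by rewrite invf_div mulrCA divff // mulr1 eqxx.
case/andP=> h _; rewrite mulcharV // -fM; congr f.
have xnz: x != 0 by apply: contraNneq h => ->; rewrite invr0 mulr0.
rewrite mulrDl divff; last by rewrite mulf_neq0 ?invr_eq0.
by rewrite invf_div mulrCA divff // mulr1.
Qed.

(** Expand the square over pairs from [V] and sum over [x] first: each diagonal pair gives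
    [#|K| - 1], and each of the [#|V| - 1] other partners of a fixed [w] gives -1 by the shifted
    sum. *)
Lemma second_moment_mulchar f V : mulchar f -> nontrivial f ->
  \sum_x `|\sum_(v in V) f (x + v)| ^+ 2 = #|V|%:R * (#|K|%:R - #|V|%:R).
Proof.
move=> fP fnt; have [f0 fM fN] := fP.
rewrite (eq_bigr (fun x => \sum_(w in V) \sum_(v in V)
                              f (x + v) * (f (x + w))^*)); last first.
  move=> x _; rewrite normCK rmorph_sum /= mulr_sumr.
  by apply: eq_bigr => w _; rewrite mulr_suml.
rewrite exchange_big /=.
rewrite (eq_bigr (fun=> #|K|%:R - #|V|%:R)); last first.
  move=> w wV; rewrite exchange_big /= (bigD1 w) //=.
  have -> : \sum_x f (x + w) * (f (x + w))^* = #|K|%:R - 1.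
    rewrite -(reindex_inj (P := xpredT) (addIr w)
                (F := fun x => f x * (f x)^*)) /=.
    rewrite (bigD1 0) //= f0 mul0r add0r.
    rewrite (eq_bigr (fun=> 1)) => [|x xnz]; last first.
      by rewrite -normCK fN // expr1n.
    by rewrite sumr_const cardC1 -subn1 natrB // (cardD1 0).
  rewrite (eq_bigr (fun=> -1)) => [|v /andP[vV vw]]; last first.
    rewrite -(sum_mulchar_shift fP fnt (d := v - w)) ?subr_eq0 //.
    rewrite [RHS](reindex_inj (addIr w)) /=; apply: eq_bigr => x _.
    by rewrite -addrA [w + _]addrC subrK.
  rewrite sumr_const (cardsD1 w V) wV.
  have -> : #|[pred i | i \in V & i != w]| = #|V :\ w|.
    by apply: eq_card => i; rewrite !inE andbC.
  by rewrite mulNrn natrD opprD addrA.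
by rewrite sumr_const mulr_natl.
Qed.

Lemma mulchar_coset_bound f V (u : K) : mulchar f -> nontrivial f ->
    0 \in V -> {in V &, forall v w, w - v \in V} ->
  `|\sum_(v in V) f (u + v)| ^+ 2 <= #|K|%:R.
Proof.
move=> fP fnt V0 VB.
have VN : {in V, forall v, - v \in V} by move=> v vV; rewrite -sub0r VB.
have VD : {in V &, forall v w, v + w \in V}.
  by move=> v w vV wV; rewrite addrC -[v]opprK VB ?VN.
have V_gt0 : 0 < #|V|%:R :> C by rewrite ltr0n (cardD1 0) V0.
rewrite -(ler_pM2l V_gt0).
apply: le_trans (_ : #|V|%:R * (#|K|%:R - #|V|%:R) <= _); last first.
  by rewrite ler_pM2l // gerBl ltW.
rewrite -(second_moment_mulchar V fP fnt).
(* Translation by an element of [V] permutes [V], so all [#|V|] points of the coset give the same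
   inner sum; the left side is thus a part of the second moment. *)
have -> : #|V|%:R * `|\sum_(v in V) f (u + v)| ^+ 2
     = \sum_(x in [set u + v | v in V]) `|\sum_(v in V) f (x + v)| ^+ 2.
  rewrite big_imset /=; last by move=> v w _ _ /addrI.
  rewrite mulr_natl -sumr_const; apply: eq_bigr => w wV.
  congr (`|_| ^+ 2); rewrite (reindex_onto (fun v => w + v) (fun v => v - w)).
    apply: eq_big => v; last by rewrite addrA.
    rewrite [w + v]addrC addrK eqxx andbT; apply/idP/idP => [h|h].
      by rewrite -[v](addrK w) VB.
    by rewrite VD.
  by move=> v _; rewrite addrC subrK.
rewrite [leRHS](bigID (mem [set u + v | v in V])) /= lerDl.
by apply: sumr_ge0 => x _; rewrite exprn_ge0.
Qed.

End CharacterSums.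

(** * Discrete logarithm, explicit characters and the sieve for primitive elements *)

Section Vinogradov.
Variables (K : finFieldType) (C : numClosedFieldType).
Local Notation N := #|K|.-1.
Variables (g : K) (z : C).
Hypotheses (gP : N.-primitive_root g) (zP : N.-primitive_root z).

(** At [x = 0], which is no power of [g], the default value is 0. *)
Definition dlog (x : K) : 'I_N :=
  odflt (Ordinal (prim_order_gt0 gP)) [pick i : 'I_N | x == g ^+ i].

(** The character sending [g] to [z ^+ j]. The index is an unreduced natural number, so that
    multiplying characters adds indices. *)
Definition chi (j : nat) (x : K) : C :=
  if x == 0 then 0 else z ^+ (j * dlog x).

Lemma gen_neq0 i : g ^+ i != 0.
Proof.
rewrite expf_neq0 //; apply: contra_eqN (prim_expr_order gP) => /eqP->.
by rewrite expr0n gtn_eqF ?(prim_order_gt0 gP) // eq_sym oner_eq0.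
Qed.

Lemma dlogK x : x != 0 -> g ^+ dlog x = x.
Proof.
move=> xnz; rewrite /dlog; case: pickP => [i /eqP<- //|noi].
have xN : x ^+ N = 1.
  apply: (mulfI xnz); rewrite mulr1 -exprS prednK ?expf_card //.
  by rewrite (cardD1 0).
by have [i xE] := prim_rootP gP xN; have := noi i; rewrite xE eqxx.
Qed.

Lemma eq_expr_dlog i x : x = g ^+ i -> dlog x = i %[mod N].
Proof.
move=> xE; apply/eqP; rewrite -(eq_prim_root_expr gP) -xE dlogK //.
by rewrite xE gen_neq0.
Qed.

Lemma dlog_gen (i : 'I_N) : dlog (g ^+ i) = i.
Proof.
by apply: val_inj; have := eq_expr_dlog (erefl (g ^+ i)); rewrite !modn_small.
Qed.

Lemma big_units (G : K -> C) : \sum_(x | x != 0) G x = \sum_(i < N) G (g ^+ i).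
Proof.
rewrite (reindex (fun i : 'I_N => g ^+ i)) /=.
  by apply: eq_bigl => i; rewrite gen_neq0.
by exists dlog => [i _|x /= xnz]; rewrite ?dlog_gen ?dlogK.
Qed.

Lemma mulchar_chi j : mulchar (chi j).
Proof.
split=> [|x y|x xnz]; rewrite /chi ?eqxx //.
  rewrite mulf_eq0; have [|xnz] := eqVneq x 0; first by rewrite mul0r.
  have [|ynz] := eqVneq y 0; first by rewrite mulr0.
  rewrite /= -exprD -mulnDr; apply/eqP.
  rewrite (eq_prim_root_expr zP) -modnMmr (@eq_expr_dlog (dlog x + dlog y)).
    by rewrite modnMmr.
  by rewrite exprD !dlogK.
rewrite (negPf xnz); apply/eqP.
rewrite -(pexpr_eq1 (prim_order_gt0 zP)) // -normrX -exprM mulnC exprM.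
by rewrite (prim_expr_order zP) expr1n normr1.
Qed.

Lemma chiD j k x : chi (j + k) x = chi j x * chi k x.
Proof. by rewrite /chi; case: eqP; rewrite ?mul0r // mulnDl exprD. Qed.

Lemma chi_trivial j x : (N %| j)%N -> chi j x = (x != 0)%:R.
Proof.
case/dvdnP=> k ->; rewrite /chi; case: eqP => //= _.
by rewrite mulnAC mulnC exprM (prim_expr_order zP) expr1n.
Qed.

Lemma chi_nontrivial j : ~~ (N %| j)%N -> nontrivial (chi j).
Proof.
move=> Nj; exists g; first by rewrite -[g]expr1 gen_neq0.
rewrite /chi -{1}[g]expr1 (negPf (gen_neq0 1)) -(expr0 z).
rewrite (eq_prim_root_expr zP) -modnMmr (@eq_expr_dlog 1) ?expr1 //.
by rewrite modnMmr muln1 mod0n.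
Qed.

Definition sieve (ps : seq nat) (x : K) : C :=
  (x != 0)%:R * \prod_(p <- ps) (p%:R / p.-1%:R * (~~ (p %| dlog x)%N)%:R).

(** A geometric sum without its constant term: the summands are the powers of a [p]-th root of unity
    that equals 1 exactly when [p] divides [dlog x]. *)
Lemma sum_chi_prime p x : prime p -> (p %| N)%N -> x != 0 ->
  \sum_(k <- iota 1 p.-1) chi (k * (N %/ p)) x
    = (if (p %| dlog x)%N then p.-1%:R else -1) :> C.
Proof.
move=> p_pr pN xnz; have p_gt0 := prime_gt0 p_pr.
set w := z ^+ (N %/ p * dlog x).
have chiE k : chi (k * (N %/ p)) x = w ^+ k.
  by rewrite /chi (negPf xnz) -exprM -mulnA mulnC.
under eq_bigr => k _ do rewrite chiE.
have w1 : (w == 1) = (p %| dlog x)%N.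
  rewrite -(expr0 z) (eq_prim_root_expr zP) mod0n.
  rewrite -/(dvdn N _) -[X in (X %| _)%N](divnK pN) dvdn_pmul2l //.
  by rewrite divn_gt0 // dvdn_leq // (prim_order_gt0 zP).
case: ifPn => [pd|pd].
  move: w1; rewrite pd => /eqP->.
  rewrite (eq_bigr (fun=> 1)) => [|k _]; last by rewrite expr1n.
  by rewrite big_const_seq count_predT size_iota iter_addr_0.
have wp : w ^+ p = 1.
  by rewrite -exprM mulnAC divnK // exprM (prim_expr_order zP) expr1n.
have := subrXX w 1 p; rewrite expr1n wp subrr => /esym/eqP.
rewrite mulf_eq0 subr_eq0 w1 (negPf pd) /=.
under eq_bigr => i _ do rewrite expr1n mulr1.
(* The factorization of [w ^+ p - 1] lists the powers in decreasing order; reversing them brings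
   [w ^+ 0] to the front, where it is split off. *)
rewrite -(big_mkord xpredT (fun i => w ^+ (p.-1 - i))) big_nat_rev /=.
rewrite big_ltn // add0n subn1 subnn expr0 addrC addr_eq0 => /eqP <-.
rewrite /index_iota subn1; apply: eq_big_seq => i.
rewrite mem_iota => /andP[i0 ip]; congr (w ^+ _).
by lia.
Qed.

(** The list holds pairs of a coefficient and a character index, repetitions allowed. Each prime
    doubles the norm bound, since its factor has coefficient 1 once and [- p.-1%:R^-1] for [p.-1]
    characters. *)
Lemma sieve_expansion ps : all prime ps -> all (dvdn^~ N) ps ->
  exists2 s : seq (C * nat), \sum_(t <- s) `|t.1| <= 2 ^+ size ps &
    forall x, sieve ps x = \sum_(t <- s) t.1 * chi t.2 x.
Proof.
elim: ps => [|p ps IHps] /=.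
  exists [:: (1, 0%N)] => [|x]; rewrite big_seq1 /= ?normr1 //.
  by rewrite /sieve big_nil mulr1 mul1r chi_trivial.
case/andP=> p_pr ps_pr /andP[pN psN]; have [s s_le sE] := IHps ps_pr psN.
have p1_gt0 : 0 < p.-1%:R :> C by rewrite ltr0n -subn1 subn_gt0 prime_gt1.
have pE : p%:R = p.-1%:R + 1 :> C.
  by rewrite natr1 prednK // prime_gt0.
exists (s ++ [seq (- p.-1%:R^-1 * t.1, (t.2 + k * (N %/ p))%N)
               | t <- s, k <- iota 1 p.-1]) => [|x].
  rewrite big_cat big_allpairs_dep /= exprS mulr_natl mulr2n lerD //.
  apply: le_trans s_le; rewrite le_eqVlt; apply/orP; left; apply/eqP.
  apply: eq_bigr => t _; rewrite big_const_seq count_predT size_iota.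
  rewrite iter_addr_0 normrM normrN normfV normr_nat -mulrnAl.
  by rewrite -mulr_natr mulVf ?mul1r // gt_eqF.
have -> : sieve (p :: ps) x
    = (1 - p.-1%:R^-1 * \sum_(k <- iota 1 p.-1) chi (k * (N %/ p)) x)
      * sieve ps x.
  rewrite /sieve big_cons; have [|xnz] := eqVneq x 0.
    by rewrite !mul0r mulr0.
  rewrite sum_chi_prime // !mul1r; congr (_ * _).
  case: ifP => _; first by rewrite mulVf ?gt_eqF // subrr mulr0.
  by rewrite mulr1 mulrN1 opprK pE mulrDl divff ?gt_eqF // mul1r.
rewrite mulrBl mul1r big_cat big_allpairs_dep /= sE; congr (_ + _).
rewrite -!mulNr mulr_sumr; apply: eq_bigr => t _.
rewrite mulr_sumr mulr_suml; apply: eq_bigr => k _.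
by rewrite chiD; ring.
Qed.

Definition log_primitive (x : K) := (x != 0) && coprime N (dlog x).

Lemma sieve_primes x : (1 < N)%N ->
  sieve (primes N) x = N%:R / (totient N)%:R * (log_primitive x)%:R.
Proof.
move=> N_gt1; have N_gt0 := ltnW N_gt1.
have kE : \prod_(p <- primes N) (p%:R / p.-1%:R) = N%:R / (totient N)%:R :> C.
  rewrite totientE // {2}(prod_prime_decomp N_gt0) prime_decompE big_map /=.
  rewrite !natr_prod -prodf_div; apply: eq_big_seq => p.
  rewrite mem_primes => /and3P[p_pr _ pN].
  have p1 := prime_gt1 p_pr.
  have l1 : (0 < logn p N)%N by rewrite logn_gt0 mem_primes p_pr N_gt0.
  (* The power of [p] in [N] and its share of the totient have a common factor [p ^ (logn p N).-1],
     which cancels. *)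
  rewrite -{1}(prednK l1) expnS !natrM -mulf_div divff ?mulr1 //.
  by rewrite pnatr_eq0 expn_eq0; lia.
rewrite /sieve big_split kE /log_primitive mulrCA; congr (_ * _).
case: eqP => //= _; rewrite ?mul0r // mul1r.
case: (boolP (coprime _ _)) => [co|nco].
  rewrite big1_seq // => p /andP[_]; rewrite mem_primes => /and3P[p_pr _ pN].
  suff -> : (p %| dlog x)%N = false by [].
  apply: contraTF co => pd; rewrite /coprime.
  have : (p %| gcdn N (dlog x))%N by rewrite dvdn_gcd pN.
  by apply: contraTN => /eqP->; rewrite dvdn1 gtn_eqF ?prime_gt1.
have [p p_pr pd] : exists2 p, prime p & (p %| gcdn N (dlog x))%N.
  exists (pdiv (gcdn N (dlog x))); last exact: pdiv_dvd.
  by apply: pdiv_prime; rewrite ltn_neqAle eq_sym nco gcdn_gt0 N_gt0.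
move: pd; rewrite dvdn_gcd => /andP[pN pd].
have pin : p \in primes N by rewrite mem_primes p_pr N_gt0.
by apply/eqP; rewrite prodf_seq_eq0; apply/hasP; exists p; rewrite //= pd.
Qed.

(** Separating the trivial characters, whose coefficients add up to 1, removes at least 1 from the
    norm bound. This saving later pays for the element 0. *)
Lemma primitive_expansion : (1 < N)%N ->
  exists2 s : seq (C * nat),
    all (fun t => ~~ (N %| t.2)%N) s /\
      \sum_(t <- s) `|t.1| <= 2 ^+ size (primes N) - 1 &
    forall x, N%:R / (totient N)%:R * (log_primitive x)%:R
      = (x != 0)%:R + \sum_(t <- s) t.1 * chi t.2 x.
Proof.
move=> N_gt1; have N_gt0 := ltnW N_gt1.
have [||s s_le sE] := @sieve_expansion (primes N).
- exact: all_prime_primes.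
- by apply/allP=> p; rewrite mem_primes => /and3P[].
(* Sum the sieve over all [x] in two ways: there are [totient N] primitive elements of weight
   [N / totient N], while in the expansion only trivial characters survive, each with sum [N]. *)
have trivial_coef : \sum_(t <- s | (N %| t.2)%N) t.1 = 1.
  have N_neq0 : N%:R != 0 :> C by rewrite pnatr_eq0 -lt0n.
  have sum1 : \sum_(x | x != 0 :> K) 1 = N%:R :> C.
    by rewrite sumr_const cardC1.
  have: \sum_x sieve (primes N) x = N%:R.
    rewrite (bigD1 0) //= {1}/sieve eqxx mul0r add0r.
    under eq_bigr => x _ do rewrite sieve_primes //.
    rewrite -mulr_sumr big_units /= totient_count_coprime big_mkord natr_sum.
    rewrite [X in _ * X](_ : _ = \sum_(d < N) (coprime N d)%:R); last first.
      by apply: eq_bigr => i _; rewrite /log_primitive gen_neq0 dlog_gen.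
    rewrite mulfVK // -natr_sum -(big_mkord xpredT (fun d => coprime N d : nat)).
    by rewrite -totient_count_coprime pnatr_eq0 -lt0n totient_gt0.
  under eq_bigr => x _ do rewrite sE.
  rewrite exchange_big /= (bigID (fun t => N %| t.2)%N) /=.
  rewrite [X in _ + X]big1 ?addr0 => [|t Nt]; last first.
    rewrite -mulr_sumr sum_mulchar ?mulr0 //; first exact: mulchar_chi.
    exact: chi_nontrivial.
  rewrite (eq_bigr (fun t => t.1 * N%:R)) => [|t Nt]; last first.
    rewrite -mulr_sumr; congr (_ * _); rewrite (bigD1 0) //= -sum1.
    rewrite chi_trivial // eqxx add0r.
    by apply: eq_bigr => x xnz; rewrite chi_trivial // xnz.
  by rewrite -mulr_suml -{2}[N%:R]mul1r => /(mulIf N_neq0).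
exists [seq t <- s | ~~ (N %| t.2)%N] => [|x].
  split; first exact: filter_all.
  rewrite big_filter lerBrDr; apply: le_trans s_le.
  rewrite [leRHS](bigID (fun t => N %| t.2)%N) /= [leRHS]addrC lerD2l.
  by rewrite -[leLHS]normr1 -trivial_coef ler_norm_sum.
rewrite -sieve_primes // sE big_filter (bigID (fun t => N %| t.2)%N) /=.
congr (_ + _); rewrite -[RHS]mul1r -[X in _ = X * _]trivial_coef mulr_suml.
by apply: eq_bigr => t Nt; rewrite chi_trivial.
Qed.

End Vinogradov.

(** * Roots of unity and generators of the unit group *)

Lemma prim_root_exists (C : numClosedFieldType) (n : nat) :
  (0 < n)%N -> exists z : C, n.-primitive_root z.
Proof.
move=> n_gt0; have [r rE] := closed_field_poly_normal ('X^n - 1 : {poly C}).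
have {}rE : 'X^n - 1 = \prod_(z <- r) ('X - z%:P).
  by rewrite rE (monicP (monicXnsubC 1 n_gt0)) scale1r.
(* In characteristic 0 the polynomial ['X^n - 1] is separable, so it has [n] distinct roots, and
   among these one is primitive. *)
have /hasP[z _ zP] : has n.-primitive_root r; last by exists z.
apply: has_prim_root => //.
- by apply/allP=> z; rewrite -root_prod_XsubC -rE.
- by rewrite -separable_prod_XsubC -rE separable_Xn_sub_1 // pnatr_eq0 -lt0n.
- by rewrite -ltnS -(size_prod_XsubC r id) -rE size_XnsubC.
Qed.

Section UnitGenerator.
Variable K : finFieldType.
Local Notation N := #|K|.-1.

Lemma unit_generator_exists :
  exists2 u : {unit K}, [set: {unit K}] = <[u]>%g & N.-primitive_root (val u).
Proof.
have /cyclicP[u uE] := field_unit_group_cyclic [set: {unit K}]%G.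
exists u => //; have ou : #[u]%g = N by rewrite /order -uE card_finField_unit.
have N_gt0 : (0 < N)%N by rewrite -ou order_gt0.
have vX k : val u ^+ k = val (u ^+ k)%g by rewrite FinRing.val_unitX.
rewrite /primitive_root_of_unity N_gt0; apply/forallP=> i.
rewrite unity_rootE vX -FinRing.val_unit1 val_eqE -order_dvdn ou; apply/eqP.
apply/idP/eqP => [|->//]; move/dvdn_leq => /(_ isT) le.
by apply/eqP; rewrite eqn_leq ltn_ord.
Qed.

End UnitGenerator.

Lemma primitive_elementE (F : finFieldType) (L : fieldExtType F)
    (u : {unit finvect_type L}) (uE : [set: {unit finvect_type L}] = <[u]>%g)
    (uP : (#|finvect_type L|.-1).-primitive_root (val u)) x :
  primitive_element x = log_primitive uP x.
Proof.
have ou : #[u]%g = #|finvect_type L|.-1.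
  by rewrite /order -uE card_finField_unit.
apply/existsP/andP=> [[w /andP[/eqP-> wgen]]|[xnz co]].
  split; first by rewrite -unitfE; apply: (valP w).
  have /cycleP[i wE] : w \in <[u]>%g by rewrite -uE inE.
  move: wgen; rewrite uE wE generator_coprime ou.
  have := @eq_expr_dlog _ _ uP i (val (u ^+ i)%g).
  rewrite FinRing.val_unitX => /(_ erefl) dE.
  by rewrite -coprime_modr -dE coprime_modr.
exists (u ^+ dlog uP x)%g; rewrite FinRing.val_unitX dlogK // eqxx uE.
by rewrite generator_coprime ou.
Qed.

(** * Counting squarefree divisors from below *)

Section SquarefreeDivisors.
Variables (I : finType) (p : I -> nat).
Hypotheses (p_inj : injective p) (p_pr : forall i, prime (p i)).
Implicit Type D : {set I}.

Lemma prime_dvd_prod_primes r D : prime r -> (r %| \prod_(i in D) p i)%N ->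
  exists2 i, i \in D & r = p i.
Proof.
move=> r_pr; rewrite Euclid_dvd_prod // big_orE => /existsP[i /andP[iD rp]].
by exists i => //; apply/eqP; rewrite -dvdn_prime2.
Qed.

Lemma squarefree_prod_primes D : squarefree (\prod_(i in D) p i)%N.
Proof.
rewrite /squarefree prodn_gt0 => [|i]; last exact: prime_gt0.
apply/allP=> e; rewrite -dvdn_divisors ?prodn_gt0 // => [ed|i]; last first.
  exact: prime_gt0.
apply/implyP=> e2; apply: contraTT e2 => e1.
have e_gt1 : (1 < e)%N.
  rewrite ltn_neqAle eq_sym e1; apply: dvdn_gt0 ed.
  by apply: prodn_gt0 => i; apply: prime_gt0.
(* The square of this prime would divide the product; after cancelling one copy, [r] would still
   divide the product over the other indices, against injectivity of [p]. *)
have r_pr := pdiv_prime e_gt1; set r := pdiv e in r_pr.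
apply/negP=> e2; have r2 : (r ^ 2 %| \prod_(i in D) p i)%N.
  by apply: dvdn_trans e2; rewrite dvdn_exp2r // pdiv_dvd.
have [i iD rE] : exists2 i, i \in D & r = p i.
  by apply: prime_dvd_prod_primes => //; apply: dvdn_trans r2; apply: dvdn_exp.
move: r2; rewrite (bigD1 i) //= -rE expnS expn1 dvdn_pmul2l ?prime_gt0 //.
rewrite (eq_bigl (mem (D :\ i))) => [|j]; last by rewrite !inE andbC.
case/prime_dvd_prod_primes=> // j; rewrite !inE rE => /andP[ji _] /p_inj ij.
by rewrite ij eqxx in ji.
Qed.

Lemma prod_primes_inj : injective (fun D => \prod_(i in D) p i)%N.
Proof.
have sub D (E : {set I}) :
    (\prod_(i in D) p i = \prod_(i in E) p i)%N -> D \subset E.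
  move=> DE; apply/subsetP=> i iD.
  have [|j jE /p_inj->//] := @prime_dvd_prod_primes (p i) E (p_pr i).
  by rewrite -DE (bigD1 i) //= dvdn_mulr.
by move=> D E DE; apply/eqP; rewrite eqEsubset !sub.
Qed.

End SquarefreeDivisors.

(** The products over subsets of the prime divisors of [N] are distinct squarefree divisors of
    [N]. *)
Lemma leq_num_squarefree_divisors N : (0 < N)%N ->
  (2 ^ size (primes N) <= num_squarefree_divisors N)%N.
Proof.
move=> N_gt0; set k := size _; pose p (i : 'I_k) := nth 0%N (primes N) i.
have pin i : p i \in primes N by apply: mem_nth.
have p_pr i : prime (p i) by have := pin i; rewrite mem_primes => /andP[].
have p_inj : injective p.
  move=> i j /eqP; rewrite nth_uniq ?primes_uniq // => /eqP.
  exact: val_inj.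
rewrite -{1}(card_ord k) -cardsT -card_powerset powersetT cardsT cardE.
rewrite -(size_map (fun D : {set 'I_k} => \prod_(i in D) p i)%N).
apply: uniq_leq_size => [|d /mapP[D _ ->]].
  by rewrite map_inj_uniq ?enum_uniq //; apply: prod_primes_inj.
rewrite mem_filter squarefree_prod_primes //= -dvdn_divisors //.
apply: (@dvdn_trans (\prod_(i < k) p i)%N).
  by rewrite [X in (_ %| X)%N](bigID (mem D)) dvdn_mulr.
have -> : (\prod_(i < k) p i = \prod_(r <- primes N) r)%N.
  by rewrite (big_nth 0%N) big_mkord.
rewrite [X in (_ %| X)%N](prod_prime_decomp N_gt0).
rewrite prime_decompE big_map /= !big_seq.
apply: (big_ind2 (fun a b => a %| b)%N) => // [*|r rN]; first exact: dvdn_mul.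
by apply: dvdn_exp => //; rewrite logn_gt0.
Qed.

(** * Inclusion-exclusion *)

(** The weight [f] is kept general, to serve both for counting and for character sums. The empty [D]
    contributes the sum over all of [T]. *)
Lemma big_avoiding_set (T : finType) (V : comNzRingType) (Cl : {set {set T}})
    (f : T -> V) :
  \sum_(x in \bigcap_(A in Cl) ~: A) f x
    = \sum_(D : {set {set T}} | D \subset Cl)
        (-1) ^+ #|D| * \sum_(x in \bigcap_(A in D) A) f x.
Proof.
have prod_ind (D : {set {set T}}) x :
    \prod_(A in D) - (x \in A)%:R
    = (-1) ^+ #|D| * (x \in \bigcap_(A in D) A)%:R :> V.
  case: (boolP (x \in _)) => [/bigcapP xD|xD].
    rewrite mulr1 -prodr_const; apply: eq_bigr => A AD.
    by rewrite xD.
  have [A AD xA] : exists2 A, A \in D & x \notin A.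
    apply/exists_inP; rewrite -negb_forall_in; apply: contra xD => /forall_inP.
    by move=> h; apply/bigcapP.
  by rewrite mulr0 (bigD1 A) //= (negPf xA) oppr0 mul0r.
have ind x : (x \in \bigcap_(A in Cl) ~: A)%:R
    = \sum_(D : {set {set T}} | D \subset Cl)
        (-1) ^+ #|D| * (x \in \bigcap_(A in D) A)%:R :> V.
  under [RHS]eq_bigr => D _ do rewrite -prod_ind.
  (* Expanding this product over all sets [A] gives one term for each family [D], and it vanishes
     unless [D] lies in [Cl]. *)
  transitivity (\prod_(A : {set T}) (- ((x \in A) && (A \in Cl))%:R + 1 : V)).
    case: (boolP (x \in _)) => [/bigcapP xC|xC].
      rewrite big1 // => A _; case: (boolP (A \in Cl)) => AC.
        by have := xC A AC; rewrite inE => /negPf->; rewrite oppr0 add0r.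
      by rewrite andbF oppr0 add0r.
    have [A AC xA] : exists2 A, A \in Cl & x \notin ~: A.
      apply/exists_inP; rewrite -negb_forall_in; apply: contra xC => /forall_inP.
      by move=> h; apply/bigcapP.
    rewrite inE negbK in xA.
    by rewrite (bigD1 A) //= xA AC addNr mul0r.
  rewrite bigA_distr /= (bigID (fun D : {set {set T}} => D \subset Cl)) /=.
  rewrite [X in _ + X]big1 ?addr0 => [|D /subsetPn[A AD AC]]; last first.
    by rewrite (bigD1 A) //= AD (negPf AC) andbF oppr0 mul0r.
  apply: eq_bigr => D DC; rewrite [RHS]big_mkcond; apply: eq_bigr => A _.
  by case: ifP => // AD; rewrite (subsetP DC) // andbT.
rewrite big_mkcond.
transitivity (\sum_x (x \in \bigcap_(A in Cl) ~: A)%:R * f x).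
  by apply: eq_bigr => x _; case: ifP; rewrite ?mul1r ?mul0r.
under [LHS]eq_bigr => x _ do rewrite ind mulr_suml.
rewrite exchange_big /=; apply: eq_bigr => D _.
rewrite [in RHS]big_mkcond mulr_sumr; apply: eq_bigr => x _.
by case: ifP; rewrite ?mulr1 // !mulr0 mul0r.
Qed.

Lemma big_subsets_card (T : finType) (V : nmodType) (S : {set T})
    (G : nat -> V) :
  \sum_(D : {set T} | D \subset S) G #|D|
    = \sum_(k < #|S|.+1) G k *+ 'C(#|S|, k).
Proof.
rewrite (partition_big (fun D : {set T} => inord #|D| : 'I_#|S|.+1) xpredT) //=.
apply: eq_bigr => k _; rewrite -cards_draws -sumr_const.
apply: eq_big => [D|D /andP[DS /eqP<-]].
  rewrite inE; case: (boolP (D \subset S)) => //= DS.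
  by rewrite -val_eqE /= inordK // ltnS subset_leq_card.
by rewrite inordK // ltnS subset_leq_card.
Qed.

(** * Character sums over affine spaces *)

Section AffineSums.
Variables (F : finFieldType) (L : fieldExtType F).
Local Notation K := (finvect_type L).
Variable C : numClosedFieldType.

Lemma card_finvect : #|K| = (#|F| ^ \dim {:L})%N.
Proof.
rewrite -(card_vspace (fullv : {vspace K})).
by apply/esym/eq_card => v; rewrite memvf.
Qed.

Lemma card_affine_space t (A : {set K}) :
  is_affine_space t A -> #|A| = (#|F| ^ t)%N.
Proof.
case=> u [V [<- ->]]; rewrite card_imset ?card_vspace //.
exact: addrI.
Qed.

(** The first bound counts points, the second is the coset bound. The latter is squared to avoid
    half-integral powers of [#|F|]. *)
Lemma affine_mulchar_bound t (A : {set K}) (f : K -> C) :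
    is_affine_space t A -> mulchar f -> nontrivial f ->
  `|\sum_(x in A) f x| <= #|F|%:R ^+ t
  /\ `|\sum_(x in A) f x| ^+ 2 <= #|F|%:R ^+ \dim {:L}.
Proof.
move=> affA fP fnt; split.
  rewrite -natrX -(card_affine_space affA) -sumr_const.
  apply: le_trans (ler_norm_sum _ _ _) _; apply: ler_sum => x _.
  case: fP => f0 _ fN; have [->|xnz] := eqVneq x 0.
    by rewrite f0 normr0 ler01.
  by rewrite fN.
case: affA => u [V [_ ->]].
rewrite big_imset /=; last by move=> v w _ _ /addrI.
rewrite -natrX -card_finvect.
have -> : \sum_(v in V) f (u + v) = \sum_(v in [set v | v \in V]) f (u + v).
  by apply: eq_bigl => v; rewrite inE.
apply: mulchar_coset_bound => //; first by rewrite inE mem0v.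
by move=> v w; rewrite !inE => vV wV; rewrite rpredB.
Qed.

End AffineSums.

(** * The complement of hyperplanes in general position *)

Section AvoidingSet.
Variables (R : realType) (F : finFieldType) (L : fieldExtType F).
Local Notation K := (finvect_type L).
Local Notation n := (\dim {:L}).
Variable Cl : {set {set K}}.
Hypotheses (Cl_card : #|Cl| = n) (Cl_gen : general_position Cl).
Local Open Scope complex_scope.

Lemma general_position_affine (D : {set {set K}}) : D \subset Cl -> D != set0 ->
  is_affine_space (n - #|D|) (\bigcap_(A in D) A).
Proof.
move=> DC D0; apply: Cl_gen => //.
by rewrite card_gt0 D0 -Cl_card subset_leq_card.
Qed.

(** Grouped by the size of [D], inclusion-exclusion becomes the binomial expansion of the right
    side. *)
Lemma card_avoiding_set :
  #|avoiding_set Cl|%:R = (#|F|%:R - 1) ^+ n :> R.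
Proof.
rewrite -sumr_const big_avoiding_set.
transitivity (\sum_(D : {set {set K}} | D \subset Cl)
                 #|F|%:R ^+ (n - #|D|) * (-1) ^+ #|D| : R).
  apply: eq_bigr => D DC; rewrite mulrC; congr (_ * _).
  rewrite sumr_const -natrX; have [->|D0] := eqVneq D set0.
    by rewrite big_set0 cardsT cards0 subn0 card_finvect.
  by rewrite (card_affine_space (general_position_affine DC D0)).
rewrite (big_subsets_card Cl (fun k => #|F|%:R ^+ (n - k) * (-1) ^+ k)).
by rewrite Cl_card exprDn.
Qed.

(** Reversing the summation makes [k.+1] the number of hyperplanes intersected, and [m - k.+1] the
    dimension left. *)
Lemma deltaE q m : delta R q m
  = \sum_(k < m) q%:R `^ Num.min (m - k.+1)%:R (m%:R / 2) *+ 'C(m, k.+1).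
Proof.
rewrite /delta big_mkord (reindex_inj rev_ord_inj) /=; apply: eq_bigr => k _.
by rewrite bin_sub ?ltn_ord // mulr_natl.
Qed.

Lemma avoiding_mulchar_bound (f : K -> R[i]) : mulchar f -> nontrivial f ->
  `|\sum_(x in avoiding_set Cl) f x| <= (delta R #|F| n)%:C.
Proof.
move=> fP fnt; rewrite big_avoiding_set.
(* The bound for a family of size [k]; it is 0 at [k = 0] because a nontrivial character sums to 0
   over the whole field. *)
pose G k : R := if k == 0%N then 0 else
  #|F|%:R `^ Num.min (n - k)%:R (n%:R / 2).
have q_ge0 : 0 <= #|F|%:R :> R by rewrite ler0n.
apply: le_trans (_ : (\sum_(D : {set {set K}} | D \subset Cl) G #|D|)%:C <= _).
  rewrite rmorph_sum; apply: le_trans (ler_norm_sum _ _ _) _.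
  apply: ler_sum => D DC; rewrite normrM normrX normrN1 expr1n mul1r.
  have [->|D0] := eqVneq D set0.
    rewrite big_set0 (eq_bigl xpredT) => [|x]; last by rewrite inE.
    by rewrite sum_mulchar // normr0 cards0 /G eqxx.
  have affD := general_position_affine DC D0.
  have [S1 S2] := affine_mulchar_bound affD fP fnt.
  rewrite /G cards_eq0 (negPf D0) /=.
  case: lerP => _; first by rewrite powR_mulrn // rmorphXn /= rmorph_nat.
  (* When the minimum is [n / 2], squares are compared, the square of the real power being
     [#|F|%:R ^+ n]. *)
  rewrite -(ler_pXn2r (n := 2)) ?nnegrE ?normr_ge0 ?ler0c ?powR_ge0 //.
  apply: le_trans S2 _.
  have -> : #|F|%:R ^+ n = (#|F|%:R ^+ n : R)%:C.
    by rewrite rmorphXn /= rmorph_nat.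
  rewrite -(rmorphXn (real_complex R)) lecR -[leRHS]powR_mulrn ?powR_ge0 //.
  by rewrite -powRrM divfK ?pnatr_eq0 // powR_mulrn.
rewrite lecR big_subsets_card Cl_card big_ord_recl /= mul0rn add0r deltaE.
by apply: ler_sum => k _.
Qed.

End AvoidingSet.

(** * Final estimate *)

Lemma delta_gt1 (R : realType) (q n : nat) : (1 < q)%N -> (1 < n)%N ->
  1 < delta R q n.
Proof.
move=> q1 n1; have n0 : (0 < n)%N := ltnW n1.
rewrite /delta big_ltn // big_ltn //.
have q1R : 1 < q%:R :> R by rewrite ltr1n.
have pow_gt0 (x : R) : 0 < q%:R `^ x by rewrite powR_gt0 // (lt_trans ltr01).
(* The term of index 0 equals 1, and the term of index 1, present since [n > 1], is positive. *)
rewrite min_l ?divr_ge0 // powRr0 bin0 mul1r -[ltLHS]addr0 ltrD2l.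
apply: ltr_pwDl; last by apply: sumr_ge0 => i _; rewrite mulr_ge0 // ltW.
by rewrite mulr_gt0 // bin1 ltr0n (ltn_trans _ n1).
Qed.

Theorem theorem3p2 (R : realType) (q n : nat) (F : finFieldType)
  (L : fieldExtType F) (C : {set {set finvect_type L}})
  (hq : #|F| = q) (hn : (2 <= n)%N) (hL : \dim {:L} = n)
  (hcard : #|C| = n)
  (hhyp : forall A, A \in C -> is_affine_hyperplane A)
  (hgen : general_position C) :
  (q%:R ^+ n - 1) / (totient (q ^ n - 1))%:R
    * (num_primitive (avoiding_set C))%:R
  > (q%:R - 1) ^+ n - delta R q n * (num_squarefree_divisors (q ^ n - 1))%:R :> R.
Proof.
have q1 : (1 < q)%N by rewrite -hq finNzRing_gt1.
have NE : (q ^ n - 1 = #|finvect_type L|.-1)%N.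
  by rewrite card_finvect hq hL subn1.
have N1 : (1 < #|finvect_type L|.-1)%N.
  rewrite -NE ltn_subRL addn1; apply: (@leq_trans (2 ^ 2)) => //.
  by apply: (@leq_trans (2 ^ n)); rewrite ?leq_exp2l ?leq_exp2r // ltnW.
have [u uE uP] := unit_generator_exists (finvect_type L).
have [z zP] := prim_root_exists R[i] (ltnW N1).
have [s [s_nt s_le] sE] := primitive_expansion uP zP N1.
have W_ge := leq_num_squarefree_divisors (ltnW N1).
have -> : q%:R ^+ n - 1 = (#|finvect_type L|.-1)%:R :> R.
  by rewrite -NE natrB ?natrX // expn_gt0 (ltnW q1).
rewrite NE; set N := #|finvect_type L|.-1 in W_ge s_le s_nt sE *.
set W := num_squarefree_divisors N in W_ge *.
set S := avoiding_set C; set P := num_primitive S; set d := delta R q n.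
have d1 : 1 < d by apply: delta_gt1.
(* The trivial character vanishes at 0, so its sum over [S] is [m], which is [#|S|] or one less. *)
pose m := #|S :\ 0|; set kP := _ * P%:R.
have P_sum : kP%:C%C
    = m%:R + \sum_(t <- s) t.1 * \sum_(x in S) chi z uP t.2 x.
  rewrite /kP; have -> : P = \sum_(x in S) (log_primitive uP x : nat).
    rewrite /P /num_primitive -sum1_card big_mkcond [RHS]big_mkcond /=.
    apply: eq_bigr => x _; rewrite inE (primitive_elementE uE).
    by case: (x \in S); case: log_primitive.
  have -> : m = \sum_(x in S) ((x != 0) : nat).
    rewrite /m -sum1_card big_mkcond [RHS]big_mkcond /=.
    by apply: eq_bigr => x _; rewrite !inE; case: (x \in S); case: (x == 0).
  rewrite rmorphM /= rmorphM /= fmorphV !rmorph_nat !natr_sum mulr_sumr.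
  under [LHS]eq_bigr => x _ do rewrite sE.
  rewrite big_split /=; congr (_ + _); rewrite exchange_big /=.
  by apply: eq_bigr => t _; rewrite mulr_sumr.
have err_le : `|\sum_(t <- s) t.1 * \sum_(x in S) chi z uP t.2 x|
    <= ((2 ^+ size (primes N) - 1) * d)%:C%C.
  apply: le_trans (ler_norm_sum _ _ _) _.
  apply: le_trans (_ : (\sum_(t <- s) `|t.1|) * d%:C%C <= _).
    rewrite mulr_suml !big_seq; apply: ler_sum => t ts.
    rewrite normrM ler_wpM2l //; rewrite /d -hq -hL.
    apply: avoiding_mulchar_bound; rewrite ?hL //; first exact: mulchar_chi.
    by apply: chi_nontrivial => //; apply: (allP s_nt).
  rewrite rmorphM rmorphB rmorphXn rmorph1 /= rmorph_nat.
  by rewrite ler_wpM2r // ler0c ltW // (lt_trans ltr01).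
(* The error is a difference of real numbers, so its complex norm is a real absolute value and the
   estimate descends to [R]. *)
have err_real : (kP - m%:R)%:C%C
    = \sum_(t <- s) t.1 * \sum_(x in S) chi z uP t.2 x.
  by rewrite rmorphB /= P_sum rmorph_nat addrC addKr.
have {err_le err_real P_sum} main : m%:R - (2 ^+ size (primes N) - 1) * d
    <= kP.
  move: err_le; rewrite -err_real => err_le.
  suff : `|kP - m%:R| <= (2 ^+ size (primes N) - 1) * d.
    by rewrite ler_norml lerBrDr addrC => /andP[].
  by rewrite -lecR; move: err_le; rewrite normc_def /= expr0n addr0 sqrtr_sqr.
apply: lt_le_trans main.
have mS : (q%:R - 1) ^+ n - 1 <= m%:R :> R.
  rewrite -hq -hL -(@card_avoiding_set R F L C) ?hL // lerBlDr natr1 ler_nat.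
  rewrite -/S [X in (X <= _)%N](cardsD1 0) -/m -add1n leq_add2r.
  by case: (0 \in S).
have WR : 2 ^+ size (primes N) <= W%:R :> R by rewrite -natrX ler_nat.
have : 2 ^+ size (primes N) * d <= W%:R * d.
  by rewrite ler_wpM2r // ltW // (lt_trans ltr01).
move: (2 ^+ _) (_ ^+ n) (W%:R) (m%:R) d d1 mS => w a b c d d1 mS wd.
(* In these names [c - (w - 1) * d >= a - 1 + d - w * d >= a - b * d + (d - 1)], and [d > 1] makes
   the inequality strict. *)
by clear -d1 mS wd; lra.
Qed.
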